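(* Let $\mathcal{C}_2$ be the class of $2$-connected cubic graphs, and let $\mathcal{G}$ be a subclass of $\mathcal{C}_2$ closed under taking minors in $\mathcal{C}_2$, i.e., if $G_1 \in \mathcal{G}$ and $G_2 \in \mathcal{C}_2$ is a minor of $G_1$, then $G_2 \in \mathcal{G}$. Let $G$ be an element of $\mathcal{G}$ having no orientable closed $2$-cell embedding (equivalently, no orientable cycle double cover) and, subject to that, having the fewest edges. Then $G$ has no $4$-cycle.
   Context: Graphs are finite and may have multiple edges but no loops. A surface is a connected compact $2$-manifold without boundary. A closed $2$-cell embedding of a graph in a surface is an embedding such that every face (component of the complement of the graph) is homeomorphic to an open disk and is bounded by a cycle (no repeated vertices) in the graph. An orientable closed $2$-cell embedding is a closed $2$-cell embedding in some orientable surface. A cycle double cover of a graph is a collection of cycles such that each edge is contained in exactly two of them; it is orientable if the cycles can be directed so that each edge is traversed once in each direction. For cubic graphs, having an orientable closed $2$-cell embedding is equivalent to having an orientable cycle double cover. *)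

(* Defs.v *)
From mathcomp Require Import all_boot perm.
Set Implicit Arguments.
Unset Strict Implicit.
Unset Printing Implicit Defensive.

(* Finite loopless multigraphs. The two ends of an edge are indexed by bool;
   this indexing is only a device for naming its two directions. *)
Record mgraph := MGraph {
  vert : finType;
  edge : finType;
  endpt : edge -> bool -> vert;
  loopless : forall e, endpt e false != endpt e true
}.

Definition incident (G : mgraph) (e : edge G) (v : vert G) : bool :=
  [exists b, endpt e b == v].

Definition cubic (G : mgraph) : Prop :=
  forall v : vert G, #|[set e | incident e v]| = 3.

Definition adjacent (G : mgraph) : rel (vert G) :=
  [rel x y | [exists e, [exists b, (endpt e b == x) && (endpt e (~~ b) == y)]]].

(* The subgraph induced by S is connected or empty. *)
Definition connected_in (G : mgraph) (S : {set vert G}) : Prop :=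
  forall x y, x \in S -> y \in S ->
    connect [rel u v | [&& u \in S, v \in S & adjacent u v]] x y.

(* Two vertices suffice, so that two vertices joined by three parallel edges
   form a 2-connected cubic graph; K_2 is also admitted, but it is not cubic. *)
Definition two_connected (G : mgraph) : Prop :=
  [/\ 1 < #|vert G|, connected_in [set: vert G]
    & forall v : vert G, connected_in [set~ v]].

Definition C2 (G : mgraph) : Prop := two_connected G /\ cubic G.

(* H is, up to isomorphism, obtained from G by deleting vertices and edges and
   contracting edges: phi sends deleted vertices to None and every other vertex
   to the vertex of H it is contracted to; psi gives the surviving edges. *)
Definition minor (H G : mgraph) : Prop :=
  exists (phi : vert G -> option (vert H)) (psi : edge H -> edge G),
    [/\ forall x : vert H, exists u, phi u = Some x,
        forall x : vert H, connected_in [set u | phi u == Some x],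
        injective psi
      & forall e : edge H, exists s : bool,
          forall b, phi (endpt (psi e) b) = Some (endpt e (s (+) b))].

(* A dart (e, b) is the edge e traversed from its end b to its end ~~ b. *)
Definition dart (G : mgraph) : finType := (edge G * bool)%type.
Definition dtail (G : mgraph) (d : dart G) : vert G := endpt d.1 d.2.
Definition dhead (G : mgraph) (d : dart G) : vert G := endpt d.1 (~~ d.2).
Definition drev (G : mgraph) (d : dart G) : dart G := (d.1, ~~ d.2).

(* A cycle of the graph with a direction and a starting point. Distinctness of
   the edges only matters for length 2, where it rules out going back and forth
   along one edge. *)
Definition dicycle (G : mgraph) (c : seq (dart G)) : bool :=
  [&& c != [::], cycle [rel d d' | dhead d == dtail d'] c,
      uniq [seq dtail d | d <- c] & uniq [seq d.1 | d <- c]].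

Definition has_4cycle (G : mgraph) : Prop :=
  exists c : seq (dart G), dicycle c /\ size c = 4.

(* Every edge is contained in exactly two of the cycles; C is a multiset. *)
Definition cycle_double_cover (G : mgraph) (C : seq (seq (dart G))) : Prop :=
  all (@dicycle G) C /\
  forall e : edge G, count (fun c => e \in [seq d.1 | d <- c]) C = 2.

(* As elements of C already carry a direction, a choice of directions of the
   cycles of a double cover is just a choice of C. *)
Definition has_orientable_cdc (G : mgraph) : Prop :=
  exists C : seq (seq (dart G)), cycle_double_cover C /\
    forall d : dart G, count (fun c => d \in c) C = 1.

(* By the Heffter-Edmonds principle, the cellular embeddings of a connected
   graph in oriented surfaces are given by its rotation systems: permutations
   of the darts whose cycles are the sets of darts leaving each vertex. *)
Definition rotation_system (G : mgraph) (r : {perm dart G}) : Prop :=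
  forall d d' : dart G, (d' \in porbit r d) = (dtail d' == dtail d).

(* Face tracing: arrive along d, then leave by the dart following its reverse
   in the rotation. The boundary walks of the faces are the orbits. *)
Definition face (G : mgraph) (r : {perm dart G}) (d : dart G) : dart G :=
  r (drev d).

(* Every face is bounded by a cycle of the graph. *)
Definition has_orientable_closed_2cell_embedding (G : mgraph) : Prop :=
  exists r : {perm dart G}, rotation_system r /\
    forall d : dart G, dicycle (orbit (face r) d).

(* Main.v *)
Require Import Defs.
From mathcomp Require Import all_boot perm zify.
Set Implicit Arguments.
Unset Strict Implicit.
Unset Printing Implicit Defensive.

(** An oriented cover is a family of directed cycles using every dart exactly
    once; in a cubic graph it is the same thing as a closed 2-cell embedding,
    because following a dart [d] by its successor on the cycle through its
    reverse is a permutation of the three darts at a vertex without fixed points.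

    Let [v1 v2 v3 v4] be a 4-cycle with edges [e1, e2, e3, e4].  Uncrossing the
    small cuts of [G - e2 - e4] with those of [G - e1 - e3] shows that one of
    these graphs, say the former, is 2-edge-connected.  Contracting edges at its
    vertices of degree 2 leads to a smaller graph of the class (or to a digon),
    which has an oriented cover, and that cover can be pulled back.  It then
    only remains to reroute the at most four cycles through [e1] and [e3] so
    that both directions of [e2] and [e4] get used. *)

(** * Rerouting a cover around a 4-cycle *)

(** Both ends are explicit, so that directed cycles can be cut into paths and reassembled by
    rewriting. *)
Fixpoint walk (G : mgraph) (x : vert G) (p : seq (dart G)) (y : vert G) : bool :=
  if p is d :: p' then (dtail d == x) && walk (dhead d) p' y else x == y.

Ltac split_bool :=
  rewrite ?negb_or; intros;
  repeat match goal with
  | H : is_true (_ && _) |- _ => case/andP: H; intros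
  end;
  repeat match goal with
  | |- is_true (_ && _) => apply/andP; split
  end;
  try first [assumption | done | by rewrite eq_sym].

(** The distinctness clauses of [dicycle]; only tails are recorded, so the final vertex of an open
    walk is left free. *)
Definition simple (G : mgraph) (p : seq (dart G)) : bool :=
  uniq [seq dtail d | d <- p] && uniq [seq d.1 | d <- p].

Lemma dtail_rev (G : mgraph) (d : dart G) : dtail (drev d) = dhead d.
Proof. by []. Qed.

Lemma dhead_rev (G : mgraph) (d : dart G) : dhead (drev d) = dtail d.
Proof. by case: d => e b; rewrite /dhead /dtail /= negbK. Qed.

Lemma drevK (G : mgraph) : involutive (@drev G).
Proof. by case=> e b; rewrite /drev /= negbK. Qed.

Lemma dtail_neq_dhead (G : mgraph) (d : dart G) : dtail d != dhead d.
Proof.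
case: d => e [] /=; rewrite /dtail /dhead /=; last exact: loopless.
by rewrite eq_sym loopless.
Qed.

Lemma walk_cat (G : mgraph) (x y : vert G) p d q :
  walk x (p ++ d :: q) y = walk x p (dtail d) && walk (dhead d) q y.
Proof.
elim: p x => [|e p IHp] x /=; first by rewrite eq_sym.
by rewrite IHp andbA.
Qed.

Lemma dicycle_cons (G : mgraph) (d : dart G) p :
  dicycle (d :: p) = walk (dhead d) p (dtail d) && simple (d :: p).
Proof.
rewrite -[LHS]/(cycle _ (d :: p) && simple (d :: p)); congr (_ && _).
suff H: forall d' (c : dart G), path [rel a b | dhead a == dtail b] d' (rcons p c) =
          walk (dhead d') p (dtail c) by exact: H.
elim: p => [|e p IHp] d' c /=; first by rewrite andbT.
by rewrite IHp eq_sym.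
Qed.

Lemma simple_cons (G : mgraph) (d : dart G) p :
  simple (d :: p) = [&& dtail d \notin [seq dtail x | x <- p],
    d.1 \notin [seq x.1 | x <- p] & simple p].
Proof. by rewrite /simple /=; case: (_ \notin _) => //=; rewrite andbCA. Qed.

Lemma simple_cat (G : mgraph) (p q : seq (dart G)) :
  simple (p ++ q) = [&& simple p, simple q,
    ~~ has (mem [seq dtail x | x <- p]) [seq dtail x | x <- q] &
    ~~ has (mem [seq x.1 | x <- p]) [seq x.1 | x <- q]].
Proof.
rewrite /simple !map_cat !cat_uniq.
by do ?case: (uniq _) => //=; do ?case: (has _ _).
Qed.

Lemma dicycle_rot (G : mgraph) i (c : seq (dart G)) : dicycle (rot i c) = dicycle c.
Proof.
rewrite /dicycle !map_rot !rot_uniq rot_cycle; congr (_ && _).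
by rewrite -!size_eq0 size_rot.
Qed.

Lemma flatten_cons (T : Type) (c : seq T) C : flatten (c :: C) = c ++ flatten C.
Proof. by []. Qed.

Lemma count_cons (T : Type) (a : pred T) x s : count a (x :: s) = a x + count a s.
Proof. by []. Qed.

Lemma count_flatten_rem (T : eqType) (C : seq (seq T)) c x : c \in C ->
  count_mem x (flatten C) = count_mem x c + count_mem x (flatten (rem c C)).
Proof.
by move=> cC; rewrite (seq.permP (perm_flatten (perm_to_rem cC))) count_cat.
Qed.

Lemma dicycle_extract (G : mgraph) (d : dart G) C c :
  all (@dicycle G) C -> c \in C -> d \in c ->
  exists p, [/\ dicycle (d :: p), all (@dicycle G) (rem c C), c =i d :: p &
    forall x, count_mem x (flatten C) =
      count_mem x (d :: p) + count_mem x (flatten (rem c C))].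
Proof.
move=> Cd cC dc; have [i p Ec] := rot_to dc.
exists p; split.
- by rewrite -Ec dicycle_rot (allP Cd).
- by apply/allP=> z /mem_rem /(allP Cd).
- by move=> x; rewrite -Ec mem_rot.
- move=> x; have /seq.permP <- : perm_eq (rot i c) (d :: p) by rewrite Ec.
  by rewrite (seq.permP (permEl (perm_rot i c))) (count_flatten_rem _ cC).
Qed.

(** An equation in [nat] rather than a case split, so that dart counts become linear arithmetic. *)
Lemma dart_eq_or_rev (G : mgraph) (d x : dart G) :
  (d == x) + (drev d == x) = (x.1 == d.1) :> nat.
Proof.
case: d x => [e b] [e' b']; rewrite /drev !xpair_eqE /= (eq_sym e').
by case: (e == e'); case: b; case: b'.
Qed.

Lemma dicycle4 (G : mgraph) (d1 d2 d3 d4 : dart G) :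
  dicycle [:: d1; d2; d3; d4] ->
  [/\ dhead d1 = dtail d2, dhead d2 = dtail d3, dhead d3 = dtail d4 &
      dhead d4 = dtail d1] /\ (d2.1 != d4.1 /\ d3.1 != d1.1).
Proof.
rewrite dicycle_cons /= => /andP[/and4P[/eqP -> /eqP -> /eqP ->] /eqP ->].
rewrite !simple_cons /= !inE !negb_or => U; split=> //.
by rewrite [d3.1 == _]eq_sym; move: U; split_bool.
Qed.

(** Reversal exchanges the roles of [d2] and [d4], which settles the symmetric cases of
    [cover_lift]. *)
Lemma dicycle4_rev (G : mgraph) (d1 d2 d3 d4 : dart G) :
  dicycle [:: d1; d2; d3; d4] -> dicycle [:: drev d1; drev d4; drev d3; drev d2].
Proof.
move=> D4; have [[h1 h2 h3 h4] _] := dicycle4 D4.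
have: simple [:: d1; d2; d3; d4] by move: D4; rewrite dicycle_cons => /andP[].
rewrite dicycle_cons /= !dhead_rev !dtail_rev h1 h2 h3 h4 !eqxx /=.
case/andP=> Ut Ue; apply/andP; split.
  (* The tail of a reversed dart is the tail of its successor; hence the reversed list of tails is
     rotated by 2, but that of edges by 3. *)
  by move: Ut; rewrite -rev_uniq -(rot_uniq 2) /= !dtail_rev h1 h2 h3 h4.
by move: Ue; rewrite -rev_uniq -(rot_uniq 3).
Qed.

(** An oriented cover of the graph without [e] and [e'], kept inside [G]. Counting darts in
    [flatten C] amounts to counting cycles, since a directed cycle repeats no dart. *)
Definition cover_avoiding (G : mgraph) (e e' : edge G) (C : seq (seq (dart G))) :=
  all (@dicycle G) C /\
  forall x, count_mem x (flatten C) = (x.1 != e) && (x.1 != e').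

Definition oriented_cover (G : mgraph) (C : seq (seq (dart G))) :=
  all (@dicycle G) C /\ forall x, count_mem x (flatten C) = 1.

(** Reduces each rerouting to a dart count: the old darts are kept and the four missing ones are
    added once. *)
Lemma cover_complete (G : mgraph) (d2 d4 : dart G) C C' : d2.1 != d4.1 ->
  cover_avoiding d2.1 d4.1 C -> all (@dicycle G) C' ->
  (forall x, count_mem x (flatten C') = count_mem x (flatten C) +
     count_mem x [:: d2; drev d2; d4; drev d4]) ->
  oriented_cover C'.
Proof.
move=> ne [_ HC] C'd H; split=> // x; rewrite H HC /=.
have := dart_eq_or_rev d2 x; have := dart_eq_or_rev d4 x.
case: (eqVneq x.1 d2.1) => [-> | _]; last by case: eqP => _ /=; lia.
by rewrite (negPf ne) /=; lia.
Qed.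

Lemma cover_notin (G : mgraph) (e e' : edge G) C c :
  cover_avoiding e e' C -> c \in C ->
  e \notin [seq x.1 | x <- c] /\ e' \notin [seq x.1 | x <- c].
Proof.
move=> [_ H] cC; split; apply/mapP=> -[x xc Ex];
  have: x \in flatten C by [apply/flattenP; exists c];
  rewrite -has_pred1 has_count H Ex eqxx ?andbF //.
Qed.

Lemma flatten_unique (T : eqType) (C : seq (seq T)) c c' d :
  count_mem d (flatten C) <= 1 ->
  c \in C -> d \in c -> c' \in C -> d \in c' -> c = c'.
Proof.
move=> le1 cC dc c'C dc'; apply/eqP; apply: contraTT le1 => ne.
rewrite (count_flatten_rem _ cC) -ltnNge -addn1 addnC addn1.
have c'r : c' \in rem c C.
  by move: c'C; rewrite (perm_mem (perm_to_rem cC)) inE eq_sym (negPf ne).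
apply: (@leq_add 1 1); rewrite -has_count has_pred1 //.
by apply/flattenP; exists c'.
Qed.

(** The edges of a directed cycle are distinct, so each occurs in one direction only. *)
Lemma dicycle_drev_notin (G : mgraph) (d : dart G) c :
  dicycle c -> d \in c -> drev d \notin c.
Proof.
move=> cd dc; have [i p Ec] := rot_to dc.
move: cd; rewrite -(dicycle_rot i) -(mem_rot i) Ec dicycle_cons simple_cons.
case/and4P=> _ _ e1p _; rewrite inE negb_or; apply/andP; split.
  by case: d {dc Ec e1p} => e []; rewrite /drev xpair_eqE andbF.
by apply: contra e1p => rp; apply/mapP; exists (drev d).
Qed.

Lemma edge_notin_sub (G : mgraph) (e : edge G) (c p : seq (dart G)) :
  {subset p <= c} -> e \notin [seq x.1 | x <- c] ->
  e \notin [seq x.1 | x <- p].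
Proof. by move=> pc; apply: contra => /mapP[x /pc xc ->]; apply: map_f. Qed.

Lemma cover_extract2 (G : mgraph) (d2 d4 d d' : dart G) C c :
  cover_avoiding d2.1 d4.1 C -> c \in C -> d \in c -> d' \in c -> d' != d ->
  exists p q, [/\ dicycle (d :: p ++ d' :: q),
    [&& d2.1 \notin [seq x.1 | x <- p], d4.1 \notin [seq x.1 | x <- p],
        d2.1 \notin [seq x.1 | x <- q] & d4.1 \notin [seq x.1 | x <- q]] &
    forall x, count_mem x c = count_mem x (d :: p ++ d' :: q)].
Proof.
move=> HC cC dc d'c d'd; have [e2c e4c] := cover_notin HC cC.
have [i p Ec] := rot_to dc.
have Hcount x : count_mem x c = count_mem x (d :: p).
  by rewrite -Ec (seq.permP (permEl (perm_rot i c))).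
move: (d'c); rewrite -(mem_rot i) Ec inE (negPf d'd) => /splitPr def_p.
have := allP HC.1 c cC; rewrite -(dicycle_rot i) Ec.
case: p / def_p Ec Hcount => p q Ec Hcount Dc.
exists p, q; split=> //.
have pc : {subset p <= c}.
  by move=> x xp; rewrite -(mem_rot i) Ec !inE mem_cat xp orbT.
have qc : {subset q <= c}.
  by move=> x xp; rewrite -(mem_rot i) Ec !inE mem_cat inE xp !orbT.
by rewrite !(edge_notin_sub pc) ?(edge_notin_sub qc).
Qed.

Lemma all_dicycle_rem (G : mgraph) (C : seq (seq (dart G))) c :
  all (@dicycle G) C -> all (@dicycle G) (rem c C).
Proof. by move=> Cd; apply/allP=> z /mem_rem /(allP Cd). Qed.

(* In the three lifting lemmas the edges [d2.1] and [d4.1] are missing from the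
   cover.  Here one cycle [d1 p d3 q] runs through both remaining edges in the
   direction of the 4-cycle; it is replaced by the 4-cycle and the two cycles
   closing up [p] and [q] through the reversed missing edges. *)
Lemma lift_split (G : mgraph) (d1 d2 d3 d4 : dart G) C c :
  dicycle [:: d1; d2; d3; d4] -> cover_avoiding d2.1 d4.1 C ->
  c \in C -> d1 \in c -> d3 \in c -> exists C', @oriented_cover G C'.
Proof.
move=> D4 HC cC d1c d3c; have [[h1 h2 h3 h4] [d24 d31]] := dicycle4 D4.
have d31' : d3 != d1 by apply: contraNneq d31 => ->.
have [p [q [pd epq Hc]]] := cover_extract2 HC cC d1c d3c d31'.
exists ([:: d1; d2; d3; d4] :: (drev d4 :: q) :: (drev d2 :: p) :: rem c C).
apply: (cover_complete d24 HC).
- have := all_dicycle_rem c HC.1; move: pd epq; rewrite /= D4.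
  rewrite !dicycle_cons !simple_cons !simple_cat !simple_cons walk_cat /=.
  rewrite map_cat !mem_cat /= !inE !dtail_rev !dhead_rev h1 h2 h3 h4 !negb_or.
  by split_bool.
- move=> x; rewrite (count_flatten_rem _ cC) Hc !flatten_cons.
  by rewrite !(count_cat, count_cons) /=; clear; lia.
Qed.

(* The cycles [d1 p (rev d3) q] and [(rev d1) r d3 s] are cut into four paths,
   each of which is closed up by two consecutive edges of the 4-cycle. *)
Lemma lift_cross (G : mgraph) (d1 d2 d3 d4 : dart G) C c c' :
  dicycle [:: d1; d2; d3; d4] -> cover_avoiding d2.1 d4.1 C ->
  c \in C -> d1 \in c -> drev d3 \in c ->
  c' \in C -> drev d1 \in c' -> d3 \in c' -> exists C', @oriented_cover G C'.
Proof.
move=> D4 HC cC d1c d3c c'C d1c' d3c'.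
have [[h1 h2 h3 h4] [d24 d31]] := dicycle4 D4.
have d31' : drev d3 != d1 by apply: contraNneq d31 => <-.
have d31'' : d3 != drev d1 by apply: contraNneq d31 => ->.
have [p [q [pd epq Hc]]] := cover_extract2 HC cC d1c d3c d31'.
have [r [s [rd ers Hc']]] := cover_extract2 HC c'C d1c' d3c' d31''.
have c'r : c' \in rem c C.
  have := c'C; rewrite (perm_mem (perm_to_rem cC)) inE => /orP[/eqP E|//].
  by move: d1c'; rewrite E (negPf (dicycle_drev_notin _ d1c)) // (allP HC.1).
(* With v1, ..., v4 the tails of [d1], ..., [d4], the path [p] runs from v2 to v4, [q] from v3 to
   v1, [r] from v1 to v3 and [s] from v4 to v2. *)
exists ([:: d4, d1 & p] :: [:: drev d4, drev d3 & q] ::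
        [:: drev d2, drev d1 & r] :: [:: d2, d3 & s] :: rem c' (rem c C)).
apply: (cover_complete d24 HC).
- have := all_dicycle_rem c' (all_dicycle_rem c HC.1).
  have := D4; move: rd ers pd epq.
  rewrite /= !dicycle_cons !simple_cons !simple_cat !simple_cons !walk_cat /=.
  rewrite !map_cat !mem_cat /= !inE !dtail_rev !dhead_rev h1 h2 h3 h4 !negb_or.
  by split_bool.
- move=> x; rewrite (count_flatten_rem _ cC) (count_flatten_rem _ c'r) Hc Hc'.
  by rewrite !flatten_cons !(count_cat, count_cons) /=; clear; lia.
Qed.

Lemma incident_dtail (G : mgraph) (d : dart G) : incident d.1 (dtail d).
Proof. by apply/existsP; exists d.2; apply: eqxx. Qed.

Lemma incident_dhead (G : mgraph) (d : dart G) : incident d.1 (dhead d).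
Proof. by apply/existsP; exists (~~ d.2); apply: eqxx. Qed.

(* A cycle through [v] uses two of the at most three edges at [v]. *)
Lemma dicycle_avoids (G : mgraph) (c : seq (dart G)) v e e' :
  #|[set f | incident f v]| <= 3 -> dicycle c -> e != e' ->
  incident e v -> incident e' v ->
  e \notin [seq x.1 | x <- c] -> e' \notin [seq x.1 | x <- c] ->
  v \notin [seq dtail x | x <- c].
Proof.
move=> v3 cd ee' ev e'v ec e'c; apply/mapP=> -[x xc vx].
have [i p Ec] := rot_to xc; have cp y : y \in x :: p -> y.1 \in [seq x.1 | x <- c].
  by rewrite -Ec mem_rot => yc; apply: map_f.
move: cd; rewrite -(dicycle_rot i) Ec dicycle_cons simple_cons => /andP[].
case: (lastP p) Ec cp => [|q y] Ec cp /=.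
  by rewrite eq_sym (negPf (dtail_neq_dhead x)).
rewrite -cats1 walk_cat /= => /andP[_ /eqP Ey] /and3P[_].
rewrite map_cat mem_cat !inE negb_or => /andP[_ xy] _.
(* Here [x] leaves [v] and [y] enters it; together with [e] and [e'] this would give four edges at
   [v]. *)
have: [set e; e'; x.1; y.1] \subset [set f | incident f v].
  apply/subsetP=> f; rewrite !inE => /orP[/orP[/orP[]|]|] /eqP->//.
    by rewrite vx incident_dtail.
  by rewrite vx -Ey incident_dhead.
have yc : y.1 \in [seq x.1 | x <- c] by apply: cp; rewrite inE mem_rcons inE eqxx orbT.
have xc' : x.1 \in [seq x.1 | x <- c] by apply: cp; rewrite inE eqxx.
move/subset_leq_card; rewrite leqNgt => /negP[]; apply: leq_trans (_ : 4 <= _).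
  by [].
rewrite -!setUA !cardsU1 !inE !negb_or cards1 ee' xy /=.
have ne f g : f \notin [seq x.1 | x <- c] -> g \in [seq x.1 | x <- c] -> f != g.
  by move=> fc gc; apply: contraNneq fc => ->.
by rewrite !ne.
Qed.

Lemma edge_notin (G : mgraph) (d : dart G) c :
  d \notin c -> drev d \notin c -> d.1 \notin [seq x.1 | x <- c].
Proof.
move=> dc rc; apply/mapP=> -[x xc E]; have := dart_eq_or_rev d x.
have ne y : y \notin c -> (y == x) = false.
  by move=> yc; apply: contraNF yc => /eqP->.
by rewrite E eqxx !ne.
Qed.

(* Cycles [d1 p] and [(rev d3) q] that do not meet the opposite edge are
   rerouted around the other three sides of the 4-cycle. *)
Lemma lift_disjoint (G : mgraph) (d1 d2 d3 d4 : dart G) C c c' :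
  cubic G -> dicycle [:: d1; d2; d3; d4] -> cover_avoiding d2.1 d4.1 C ->
  c \in C -> d1 \in c -> d3 \notin c -> drev d3 \notin c ->
  c' \in C -> drev d3 \in c' -> d1 \notin c' -> drev d1 \notin c' ->
  exists C', @oriented_cover G C'.
Proof.
move=> G3 D4 HC cC d1c d3c r3c c'C r3c' d1c' r1c'.
have [[h1 h2 h3 h4] [d24 d31]] := dicycle4 D4.
have [e2c e4c] := cover_notin HC cC; have [e2c' e4c'] := cover_notin HC c'C.
have e3c := edge_notin d3c r3c; have e1c' := edge_notin d1c' r1c'.
have c'r : c' \in rem c C.
  have := c'C; rewrite (perm_mem (perm_to_rem cC)) inE => /orP[/eqP E|//].
  by rewrite -E r3c' in r3c.
have [p [pd _ Ec Hc]] := dicycle_extract HC.1 cC d1c.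
have [q [qd C'd Ec' Hc']] :=
  dicycle_extract (all_dicycle_rem c HC.1) c'r r3c'.
have pc : {subset p <= c} by move=> x xp; rewrite Ec inE xp orbT.
have qc : {subset q <= c'} by move=> x xp; rewrite Ec' inE xp orbT.
(* The rerouted cycles stay simple: at each end of the opposite side, the old cycle misses both that
   side and one of the deleted edges, hence the vertex itself. *)
have avoid (b : seq (dart G)) r v e e' : b \in C -> {subset r <= b} -> e != e' ->
    incident e v -> incident e' v -> e \notin [seq x.1 | x <- b] ->
    e' \notin [seq x.1 | x <- b] -> v \notin [seq dtail x | x <- r].
  move=> bC rb ne ev e'v eb e'b.
  have: v \notin [seq dtail x | x <- b].
    by apply: (dicycle_avoids _ _ ne); rewrite ?G3 ?(allP HC.1).
  by apply: contra => /mapP[x /rb xb ->]; apply: map_f.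
have U : simple [:: d1; d2; d3; d4] by move: D4; rewrite dicycle_cons => /andP[].
have v3 : dtail d3 \notin [seq dtail x | x <- p].
  apply: (avoid c p _ d2.1 d3.1) => //; last exact: incident_dtail.
    by move: U; rewrite !simple_cons /= !inE; split_bool.
  by rewrite -h2 incident_dhead.
have v4 : dtail d4 \notin [seq dtail x | x <- p].
  apply: (avoid c p _ d3.1 d4.1) => //; last exact: incident_dtail.
    by move: U; rewrite !simple_cons /= !inE; split_bool.
  by rewrite -h3 incident_dhead.
have v1 : dtail d1 \notin [seq dtail x | x <- q].
  apply: (avoid c' q _ d4.1 d1.1) => //; last exact: incident_dtail.
    by move: U; rewrite !simple_cons /= !inE; split_bool.
  by rewrite -h4 incident_dhead.
have v2 : dtail d2 \notin [seq dtail x | x <- q].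
  apply: (avoid c' q _ d1.1 d2.1) => //; last exact: incident_dtail.
    by move: U; rewrite !simple_cons /= !inE; split_bool.
  by rewrite -h1 incident_dhead.
exists ([:: drev d4, drev d3, drev d2 & p] :: [:: d4, d1, d2 & q]
          :: rem c' (rem c C)).
apply: (cover_complete d24 HC).
- have := edge_notin_sub pc e2c; have := edge_notin_sub pc e4c.
  have := edge_notin_sub pc e3c; have := edge_notin_sub qc e1c'.
  have := edge_notin_sub qc e2c'; have := edge_notin_sub qc e4c'.
  move: U pd qd; rewrite /= !dicycle_cons !simple_cons.
  rewrite /= !inE !dtail_rev !dhead_rev h1 h2 h3 h4 !eqxx !negb_or.
  by split_bool.
- by move=> x; rewrite Hc Hc' !flatten_cons !(count_cat, count_cons) /=; clear; lia.
Qed.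

(** Let [a], [a'], [b], [b'] be the cycles through [d1], [drev d1], [d3], [drev d3]. If [a] contains
    [d3], or [a'] contains [drev d3], a split applies. Otherwise, if [a] contains [drev d3] and [a']
    contains [d3], the crossing case applies. In the remaining cases [a] and [b'], or [a'] and [b],
    each miss the opposite edge. *)
Theorem cover_lift (G : mgraph) (d1 d2 d3 d4 : dart G) C :
  cubic G -> dicycle [:: d1; d2; d3; d4] -> cover_avoiding d2.1 d4.1 C ->
  exists C', @oriented_cover G C'.
Proof.
move=> G3 D4 HC; have D4' := dicycle4_rev D4.
have HC' : cover_avoiding (drev d4).1 (drev d2).1 C.
  by split=> [|x]; [exact: HC.1 | rewrite HC.2 andbC].
have U : simple [:: d1; d2; d3; d4] by move: D4; rewrite dicycle_cons => /andP[].
have get d : d.1 != d2.1 -> d.1 != d4.1 -> exists2 c, c \in C & d \in c.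
  move=> n2 n4; apply/flattenP; rewrite -has_pred1 has_count.
  by rewrite HC.2 n2 n4.
have [n12 n14 n32 n34] :
    [/\ d1.1 != d2.1, d1.1 != d4.1, d3.1 != d2.1 & d3.1 != d4.1].
  by split; move: U; rewrite !simple_cons /= !inE; split_bool.
have [a aC d1a] := get d1 n12 n14; have [a' a'C d1a'] := get (drev d1) n12 n14.
have [b bC d3b] := get d3 n32 n34; have [b' b'C d3b'] := get (drev d3) n32 n34.
have uniq_c c c' d := @flatten_unique _ C c c' d (leq_trans (eq_leq (HC.2 d)) (leq_b1 _)).
have [d3a|d3a] := boolP (d3 \in a); first exact: lift_split D4 HC aC d1a d3a.
have [r3a'|r3a'] := boolP (drev d3 \in a').
  exact: lift_split D4' HC' a'C d1a' r3a'.
have [r3a|r3a] := boolP (drev d3 \in a); last first.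
  apply: (lift_disjoint G3 D4 HC aC d1a d3a r3a b'C d3b').
    by apply: contra r3a => d1b'; rewrite (uniq_c _ _ _ aC d1a b'C d1b').
  by apply: contra r3a' => d1b'; rewrite (uniq_c _ _ _ a'C d1a' b'C d1b').
have [d3a'|d3a'] := boolP (d3 \in a').
  exact: lift_cross D4 HC aC d1a r3a a'C d1a' d3a'.
apply: (lift_disjoint G3 D4' HC' a'C d1a' r3a'  _ bC); rewrite ?drevK //.
  by apply: contra d3a' => d1b'; rewrite (uniq_c _ _ _ a'C d1a' bC d1b').
by apply: contra d3a => d1b'; rewrite (uniq_c _ _ _ aC d1a bC d1b').
Qed.

(** * Covers and embeddings *)

Lemma count_mem_flatten (G : mgraph) (C : seq (seq (dart G))) d :
  all (@dicycle G) C -> count_mem d (flatten C) = count (fun c => d \in c) C.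
Proof.
elim: C => //= c C IHC /andP[/and4P[_ _ /map_uniq Uc _] /IHC E].
by rewrite count_cat E count_uniq_mem.
Qed.

Lemma has_orientable_cdcP (G : mgraph) :
  has_orientable_cdc G <-> exists C, @oriented_cover G C.
Proof.
split=> [[C [[Cd _] HC]]|[C [Cd HC]]]; exists C; split=> //.
- by move=> d; rewrite count_mem_flatten.
- split=> // e; have E1 b : count (fun c : seq (dart G) => (e, b) \in c) C = 1.
    by rewrite -count_mem_flatten.
  (* No cycle contains both darts of [e], so the cycles through [e] are counted by adding the counts
     of its two darts. *)
  rewrite -[2]/(1 + 1) -{1}(E1 false) -(E1 true) -count_predUI.
  have/eq_in_count E0 : {in C, predI (fun c => (e, false) \in c)
      (fun c => (e, true) \in c) =1 pred0}.
    move=> c /(allP Cd) cd; apply/negP=> /= /andP[ef].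
    by rewrite (negPf (dicycle_drev_notin cd ef)).
  rewrite E0 count_pred0 addn0; apply: eq_count => c /=.
  apply/mapP/orP => [[[e' b] /= bc ->]|].
    by case: b bc; [right | left].
  by case=> bc; [exists (e, false) | exists (e, true)].
- by move=> d; rewrite -count_mem_flatten.
Qed.

(** In the absence of loops, a dart leaving [v] is determined by its edge. *)
Lemma cubic_darts (G : mgraph) (v : vert G) :
  #|[set d : dart G | dtail d == v]| = #|[set e | incident e v]|.
Proof.
rewrite -(card_in_imset (f := fst) (D := [set d : dart G | dtail d == v])).
  apply: eq_card => e; rewrite inE; apply/imsetP/existsP => [[[e' b]]|[b eb]].
    by rewrite inE => /= ev ->; exists b.
  by exists (e, b); rewrite ?inE.
case=> e b [e' b']; rewrite !inE /dtail /= => /eqP ev /eqP ev' E.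
move: E ev' => <- ev'; congr pair; apply/eqP.
have := loopless e; case: b b' ev ev' => [] [] //= -> ->; rewrite eqxx //.
Qed.

Lemma face_inj (G : mgraph) (r : {perm dart G}) : injective (face r).
Proof. by move=> x y /perm_inj /(can_inj (@drevK G)). Qed.

(** The face orbits, one for each root of [face r], partition the darts. *)
Lemma embedding_cover (G : mgraph) :
  has_orientable_closed_2cell_embedding G -> exists C, @oriented_cover G C.
Proof.
move=> [r [_ rd]]; have fsym := fconnect_sym (@face_inj _ r).
exists [seq orbit (face r) d | d <- enum (froots (face r))].
have Cd : all (@dicycle G) [seq orbit (face r) d | d <- enum (froots (face r))].
  by apply/allP=> c /mapP[d _ ->].
split=> // d; rewrite count_mem_flatten // count_map.
rewrite -[RHS](_ : count_mem (froot (face r) d) (enum (froots (face r))) = 1).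
  apply: eq_in_count => x; rewrite mem_enum => /eqP rx /=.
  by rewrite -fconnect_orbit -{2}rx; apply/(rootP fsym)/eqP => [|->].
rewrite count_uniq_mem ?enum_uniq // mem_enum.
by rewrite (_ : _ \in _ = true) //; apply: (roots_root fsym).
Qed.

Lemma cover_embedding (G : mgraph) C : cubic G -> @oriented_cover G C ->
  has_orientable_closed_2cell_embedding G.
Proof.
move=> G3 [Cd HC].
(* The cycle of [C] through [d]; by [has_cyc] the default value is never reached. *)
pose cyc d := nth [::] C (find (fun c : seq (dart G) => d \in c) C).
have has_cyc d : has (fun c : seq (dart G) => d \in c) C.
  by rewrite has_count -count_mem_flatten // HC.
have cycC d : cyc d \in C by rewrite mem_nth // -has_find.
have mem_cyc d : d \in cyc d by apply: (nth_find [::] (has_cyc d)).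
have cycE c d : c \in C -> d \in c -> cyc d = c.
  by move=> cC dc; apply: (@flatten_unique _ C _ _ d); rewrite ?HC.
pose f d := next (cyc d) d.
have Ucyc d : uniq (cyc d).
  by have /and4P[_ _ /map_uniq] := allP Cd _ (cycC d).
have fcyc d : f d \in cyc d by rewrite mem_next.
have f_inj : injective f.
  move=> x y E; have Exy : cyc x = cyc y.
    by rewrite -(cycE (cyc x) (f x)) ?cycC // -(cycE (cyc y) (f x)) ?E ?cycC.
  by rewrite -(prev_next (Ucyc x) x) -/(f x) E /f -Exy prev_next.
have f_head d : dtail (f d) = dhead d.
  have /and4P[_ cd _ _] := allP Cd _ (cycC d).
  by have /eqP := next_cycle cd (mem_cyc d).
have f_rev d : f d != drev d.
  apply: contraTneq (fcyc d) => ->.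
  by apply: dicycle_drev_notin (mem_cyc d); rewrite (allP Cd).
(* Rotating [d] to the successor of its reverse makes [face r] the successor map [f]; by [f_rev]
   this rotation has no fixed point. *)
have r_inj : injective (f \o @drev G) by exact: inj_comp (can_inj (@drevK G)).
pose r := perm r_inj; have rE d : r d = f (drev d) by rewrite permE.
have rt d : dtail (r d) = dtail d by rewrite rE f_head dhead_rev.
have r_neq d : r d != d by rewrite rE -{2}(drevK d).
exists r; split=> [d d'|d].
  pose D := [set x : dart G | dtail x == dtail d].
  have D3 : #|D| = 3 by rewrite cubic_darts G3.
  have sub x : x \in D -> porbit r x \subset D.
    move=> xD; apply/subsetP=> y /porbitP[n ->]; elim: n => [|n IHn].
      by rewrite perm1.
    by rewrite expgSr permM inE rt; move: IHn; rewrite inE.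
  (* Orbits have at least two elements and stay among the three darts at a vertex, which leaves no
     room for two disjoint orbits. *)
  have gt1 x : 1 < #|porbit r x|.
    rewrite (cardD1 x) (cardD1 (r x)) !inE r_neq -{2}(expg1 r) mem_porbit.
    by rewrite porbit_id.
  have dD : d \in D by rewrite inE.
  suff -> : porbit r d = D by rewrite inE.
  apply/eqP; rewrite eqEsubset sub //=; apply/subsetP=> x xD.
  apply: contraT => xd; have: #|porbit r d| + #|porbit r x| <= #|D|.
    rewrite -cardsUI [_ :&: _](_ : _ = set0) ?cards0 ?addn0.
      by rewrite subset_leq_card // subUset !sub.
    apply/setP=> y; rewrite !inE; apply/negP=> /andP[yd yx].
    rewrite -eq_porbit_mem in yd.
    by move: xd; rewrite -(eqP yd) porbit_sym yx.
  have := gt1 d; have := gt1 x; rewrite D3; lia.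
have Ef : face r =1 f by move=> x; rewrite /face rE drevK.
have cyc_f : fcycle (face r) (cyc d).
  apply: cycle_from_next => // x xd.
  by rewrite /= Ef /f (cycE (cyc d)) ?cycC.
have [i ->] := orbit_rot_cycle cyc_f (Ucyc d) (mem_cyc d).
by rewrite dicycle_rot (allP Cd).
Qed.

(** * Cuts, connectivity and minors *)

Definition cut (G : mgraph) (S : {set vert G}) : {set edge G} :=
  [set e | (endpt e false \in S) != (endpt e true \in S)].

(** Empty cuts are excluded too, so connectedness is part of the notion. *)
Definition two_edge_connected (G : mgraph) : bool :=
  [forall S : {set vert G}, (S != set0) && (S != setT) ==> (1 < #|cut S|)].

Lemma two_edge_connectedP (G : mgraph) :
  reflect (forall (S : {set vert G}) x y, x \in S -> y \notin S -> 1 < #|cut S|)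
          (two_edge_connected G).
Proof.
apply: (iffP forallP) => [H S x y xS yS | H S].
  apply: (implyP (H S)); apply/andP; split; first by apply/set0Pn; exists x.
  by apply: contraNneq yS => ->; rewrite inE.
apply/implyP=> /andP[/set0Pn[x xS]]; rewrite -(inj_eq (@setC_inj _)) setCT.
by case/set0Pn=> y; rewrite inE; apply: H xS.
Qed.

Lemma in_cut (G : mgraph) (S : {set vert G}) (d : dart G) :
  (d.1 \in cut S) = ((dtail d \in S) != (dhead d \in S)).
Proof. by case: d => e []; rewrite /dtail /dhead inE //= eq_sym. Qed.

Lemma cutC (G : mgraph) (S : {set vert G}) : cut (~: S) = cut S.
Proof. by apply/setP=> e; rewrite !inE; do 2!case: (_ \in S). Qed.

Lemma cut1 (G : mgraph) (v : vert G) : cut [set v] = [set e | incident e v].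
Proof.
apply/setP=> e; rewrite !inE.
rewrite /incident; apply/idP/existsP => [|[b]].
  have [<- _|_] := eqVneq (endpt e false) v; first by exists false.
  by have [<-|] := eqVneq (endpt e true) v; first by exists true.
case: b => /eqP <-; rewrite eqxx; first by rewrite (negPf (loopless e)).
by rewrite eq_sym [_ == endpt e false]eq_sym (negPf (loopless e)).
Qed.

Lemma cut_dart (G : mgraph) (S : {set vert G}) e :
  e \in cut S -> exists d : dart G, [/\ d.1 = e, dtail d \in S & dhead d \notin S].
Proof.
rewrite inE; case E: (endpt e false \in S) => /= H.
  by exists (e, false).
exists (e, true); rewrite /dtail /dhead /= E; split=> //.
by move: H; case: (_ \in S).
Qed.

Lemma incident_dart (G : mgraph) (v : vert G) e :
  e \in cut [set v] -> exists d : dart G, d.1 = e /\ dtail d = v.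
Proof. by case/cut_dart=> d [de /set1P dv _]; exists d. Qed.

Lemma adjacentP (G : mgraph) (x y : vert G) :
  reflect (exists d : dart G, dtail d = x /\ dhead d = y) (adjacent x y).
Proof.
apply: (iffP existsP) => [[e /existsP[b /andP[/eqP ex /eqP ey]]]|[[e b] [ex ey]]].
  by exists (e, b).
by exists e; apply/existsP; exists b; apply/andP; split; apply/eqP.
Qed.

Lemma connected_in_cut (G : mgraph) (T S : {set vert G}) x y :
  connected_in T -> x \in T -> y \in T -> x \in S -> y \notin S ->
  exists d : dart G, [/\ dtail d \in T, dhead d \in T, dtail d \in S & dhead d \notin S].
Proof.
move=> Tc xT yT xS yS; have /connectP[p] := Tc x y xT yT.
elim: p x xS {xT} => /= [x xS _ E|z p IHp x xS /andP[/and3P[xT zT /adjacentP]]].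
  by rewrite E xS in yS.
move=> [d [dx dz]]; have [zS|zS _ _] := boolP (z \in S); first exact: IHp.
by exists d; rewrite dx dz.
Qed.

(** Let [d] leave [S] from its tail [x]. Another edge at [x] either leaves [S] as well or leads to
    another vertex of [S]; in the latter case the graph without [x] is connected and contains an
    edge leaving [S]. The degree bound excludes K_2. *)
Lemma two_connected_2ec (G : mgraph) : two_connected G ->
  (forall v : vert G, 1 < #|cut [set v]|) -> two_edge_connected G.
Proof.
move=> [_ Gc Gvc] deg; apply/two_edge_connectedP=> S x0 y0 x0S y0S.
have [d [_ _ xS yS]] := connected_in_cut Gc (in_setT x0) (in_setT y0) x0S y0S.
set x := dtail d in xS; set y := dhead d in yS.
have dS : d.1 \in cut S by rewrite in_cut xS (negPf yS).
have two f : f != d.1 -> f \in cut S -> 1 < #|cut S|.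
  move=> fd fS; rewrite (cardD1 d.1) dS (cardD1 f) !inE fd /=.
  by move: fS; rewrite inE => ->.
have /card_gt1P[f [g [fx gx fg]]] := deg x.
have [{f g fx gx fg} f fx fd] : exists2 f, f \in cut [set x] & f != d.1.
  by have [E|] := eqVneq f d.1; [exists g; rewrite // -E eq_sym | exists f].
have [c [cf cx]] := incident_dart fx; rewrite -cf in fd.
have [zS|zS] := boolP (dhead c \in S); last first.
  by apply: (two c.1 fd); rewrite in_cut cx xS (negPf zS).
have zx : dhead c \in [set~ x] by rewrite !inE -cx eq_sym dtail_neq_dhead.
have yx : y \in [set~ x] by rewrite !inE eq_sym dtail_neq_dhead.
have [b [bx b'x bS b'S]] := connected_in_cut (Gvc x) zx yx zS yS.
apply: (two b.1); last by rewrite in_cut bS (negPf b'S).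
apply: contraTneq xS => E; have := incident_dtail d; rewrite -E -/x.
move: bx b'x; rewrite !inE => bx b'x /existsP[s /eqP sx].
move: bx b'x; rewrite -sx /dtail /dhead.
by case: (b) s {sx} => [? []] [] /=; rewrite eqxx.
Qed.

(** If [T] were disconnected, the cuts of a component and of the rest of [T] would be disjoint
    subsets of [cut T] with at least two edges each, four in total. *)
Lemma connected_in_2ec (G : mgraph) (T : {set vert G}) :
  two_edge_connected G -> #|cut T| <= 3 -> connected_in T.
Proof.
move=> /two_edge_connectedP G2 T3 x y xT yT; apply: contraT => xy.
set R := fun u v : vert G => _ in xy.
pose S := [set u in T | connect R x u].
have xS : x \in S by rewrite inE xT connect0.
have yS : y \in T :\: S by rewrite !inE yT xy.
have sep (d : dart G) : dtail d \in S -> dhead d \notin T :\: S.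
  rewrite !inE => /andP[dT xd]; apply/negP=> /andP[]; move/negP=> H dT'.
  apply: H; rewrite dT' /=; apply: connect_trans xd (connect1 _).
  by rewrite /R /= dT dT'; apply/adjacentP; exists d.
have sub : [/\ cut S \subset cut T, cut (T :\: S) \subset cut T &
    [disjoint cut S & cut (T :\: S)]].
  have ST u : u \in S -> u \in T by rewrite inE => /andP[].
  have TE u : u \in T -> (u \in S) || (u \in T :\: S) by rewrite in_setD => ->; rewrite andbT orbN.
  split; first 1 last.
  - apply/subsetP=> e /cut_dart[d [<-]]; rewrite [in X in X -> _]in_setD => /andP[dS dT] d'.
    rewrite in_cut dT; apply: contra d' => /eqP/esym/TE/orP[/(sep (drev d))|//].
    by rewrite dhead_rev in_setD dS dT.
  - rewrite -setI_eq0; apply/eqP/setP=> e; rewrite [RHS]inE in_setI.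
    apply/negP=> /andP[/cut_dart[d [<- dS d'S]]]; rewrite in_cut (negPf (sep _ dS)).
    by rewrite in_setD dS.
  - apply/subsetP=> e /cut_dart[d [<-]] dS d'S; rewrite in_cut (ST _ dS).
    by apply: contra d'S => /eqP/esym/TE; rewrite (negPf (sep _ dS)) orbF.
have [ST S'T dis] := sub.
have S2 : 1 < #|cut S|.
  by apply: (G2 _ _ y xS); apply: contraTN yS; rewrite in_setD => ->.
have S'2 : 1 < #|cut (T :\: S)|.
  by apply: (G2 _ _ x yS); rewrite in_setD xS.
have : #|cut S :|: cut (T :\: S)| <= #|cut T| by rewrite subset_leq_card // subUset ST.
rewrite cardsU (disjoint_setI0 dis) cards0 subn0.
by move: T3 S2 S'2; clear; lia.
Qed.

Lemma two_connected_of_2ec (G : mgraph) : 1 < #|vert G| -> two_edge_connected G ->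
  (forall v : vert G, #|cut [set v]| <= 3) -> two_connected G.
Proof.
move=> G1 G2 deg; split=> // [|v]; apply: connected_in_2ec => //.
  by rewrite (_ : cut _ = set0) ?cards0 //; apply/setP=> e; rewrite !inE.
by rewrite cutC.
Qed.

(** A path in [T] lifts edge by edge along [psi], and the gaps are bridged inside the connected
    fibres of [phi]. This gives connected fibres for a composition of minors. *)
Lemma connected_in_preim (G K : mgraph) (phi : vert G -> option (vert K))
    (psi : edge K -> edge G) (T : {set vert K}) :
  (forall x, connected_in [set u | phi u == Some x]) ->
  (forall e, exists s : bool,
     forall b, phi (endpt (psi e) b) = Some (endpt e (s (+) b))) ->
  connected_in T -> connected_in [set u | if phi u is Some w then w \in T else false].
Proof.
move=> fib psiP Tc u u'; set P := [set _ | _].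
have PE u0 w : phi u0 = Some w -> (u0 \in P) = (w \in T) by rewrite inE => ->.
have sub w a a' : w \in T -> phi a = Some w -> phi a' = Some w ->
    connect [rel u v | [&& u \in P, v \in P & adjacent u v]] a a'.
  move=> wT aw a'w; have := fib w a a'; rewrite !inE aw a'w eqxx => /(_ isT isT).
  apply: connect_sub => b b'; rewrite [X in X -> _]/= => /and3P[].
  rewrite !in_set => /eqP bw /eqP b'w bb'; apply: connect1.
  by rewrite /= (PE _ _ bw) (PE _ _ b'w) wT.
rewrite !inE; case Eu: (phi u) => [w|//]; case Eu': (phi u') => [w'|//] wT w'T.
have /connectP[p] := Tc _ _ wT w'T.
elim: p w wT u Eu => /= [w wT u Eu _ E|z p IHp w wT u Eu].
  by apply: (sub w) => //; rewrite -E.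
case/andP=> /and3P[_ zT /adjacentP[[e b] [ew ez]]] pz lz.
have [s sP] := psiP e.
have bw : phi (endpt (psi e) (s (+) b)) = Some w by rewrite sP addKb -ew.
have bz : phi (endpt (psi e) (s (+) ~~ b)) = Some z by rewrite sP addKb -ez.
apply: connect_trans (sub w _ _ wT Eu bw) _.
apply: connect_trans (IHp z zT _ bz pz lz); apply: connect1.
rewrite /= (PE _ w) // (PE _ z) // wT zT /=; apply/adjacentP.
by exists (psi e, s (+) b); split; rewrite // /dhead /= -addbN.
Qed.

Lemma minor_refl (G : mgraph) : minor G G.
Proof.
exists (@Some _), id; split=> // [x|x|e]; first by exists x.
  move=> u v; rewrite !inE => /eqP[->] /eqP[->]; exact: connect0.
by exists false.
Qed.

Lemma minor_trans (H K G : mgraph) : minor H K -> minor K G -> minor H G.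
Proof.
move=> [phi [psi [phiS phiC psiI psiP]]] [phi' [psi' [phiS' phiC' psiI' psiP']]].
exists (fun u => obind phi (phi' u)), (psi' \o psi); split=> [x|x||e].
- by have [w wx] := phiS x; have [u uw] := phiS' w; exists u; rewrite uw.
- rewrite (_ : [set u | _] = [set u | if phi' u is Some w then
      w \in [set w | phi w == Some x] else false]).
    exact: connected_in_preim (phiC x).
  by apply/setP=> u; rewrite !inE; case: (phi' u) => //= w; rewrite inE.
- exact: inj_comp.
- have [s sP] := psiP e; have [s' sP'] := psiP' (psi e).
  by exists (s (+) s') => b; rewrite /= sP' /= sP addbA.
Qed.

(** * Suppressing vertices of degree two *)

Section Contraction.
Variables (G : mgraph) (v : vert G) (y : {u : vert G | u != v}) (b : edge G).

(** The default value of [insubd] performs the contraction: [v] goes to [y] and every other vertex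
    to itself. *)
Definition retract (u : vert G) : {u : vert G | u != v} := insubd y u.

Hypothesis retract_loopless :
  forall e : {e : edge G | e != b},
    retract (endpt (val e) false) != retract (endpt (val e) true).
Hypothesis retract_b : forall s, retract (endpt b s) = y.

Definition contraction : mgraph :=
  @MGraph {u : vert G | u != v} {e : edge G | e != b}
    (fun e s => retract (endpt (val e) s)) retract_loopless.

Lemma val_retract u : val (retract u) = if u != v then u else val y.
Proof. by rewrite /retract val_insubd. Qed.

Lemma retract_val w : retract (val w) = w.
Proof. by apply: val_inj; rewrite val_retract (valP w). Qed.

(** Both ends of [b] have the same image, so [b] belongs to no pulled-back cut. *)
Lemma cut_contraction (S : {set vert contraction}) :
  #|cut S| = #|cut (retract @^-1: S)|.
Proof.
rewrite -(card_imset (mem (cut S)) val_inj).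
apply: eq_card => e; apply/imsetP/idP => [[e' e'S ->]|eS].
  by move: e'S; rewrite !inE.
have eb : e != b.
  by apply: contraTneq eS => ->; rewrite !inE !retract_b eqxx.
by exists (Sub e eb); rewrite ?SubK //; move: eS; rewrite !inE.
Qed.

Lemma contraction_2ec : two_edge_connected G -> two_edge_connected contraction.
Proof.
move=> /two_edge_connectedP G2; apply/two_edge_connectedP=> S x z xS zS.
rewrite cut_contraction; apply: (G2 _ (val x) (val z)).
  by rewrite inE retract_val.
by rewrite inE retract_val.
Qed.

(** The fibre over [y] consists of [v] and [y], joined by [b]; all other fibres are single
    vertices. *)
Lemma contraction_minor : b \in cut [set v] -> minor contraction G.
Proof.
move=> bv; exists (fun u => Some (retract u)), val; split.
- by move=> w; exists (val w); rewrite retract_val.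
- move=> w u u'; rewrite !inE => /eqP[Eu] /eqP[Eu'].
  have [d [db dv]] := incident_dart bv.
  have dy : dhead d = val y.
    have dn : dhead d != v by rewrite -dv eq_sym dtail_neq_dhead.
    have := congr1 val (retract_b (~~ d.2)); rewrite -db val_retract.
    by rewrite -[endpt _ _]/(dhead d) dn.
  have [Euu|uu'] := eqVneq u u'; first by rewrite Euu connect0.
  have := congr1 val Eu; have := congr1 val Eu'; rewrite !val_retract.
  have [E'|nu'] := eqVneq u' v; have [E|nu] := eqVneq u v => /=.
  + by rewrite E E' eqxx in uu'.
  + move=> Ey Ew; apply: connect1; rewrite /= !inE Eu Eu' !eqxx /=.
    apply/adjacentP; exists (drev d).
    by rewrite dtail_rev dhead_rev dy dv E'; split=> //; apply: etrans Ey (esym Ew).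
  + move=> Ey Ew; apply: connect1; rewrite /= !inE Eu Eu' !eqxx /=.
    apply/adjacentP; exists d; rewrite dy dv E; split=> //.
    exact: etrans Ew (esym Ey).
  + by move=> E' E; rewrite E E' eqxx in uu'.
- exact: val_inj.
- by move=> e; exists false => s; case: s.
Qed.

End Contraction.

Section Subdivision.
Variables (G : mgraph) (da db : dart G).
Hypotheses (dab : da.1 != db.1) (tab : dtail da = dtail db).
Hypothesis hab : dhead da != dhead db.
Hypothesis deg2 : cut [set dtail db] = [set da.1; db.1].

Let v := dtail db.

Lemma head_neq : dhead db != v.
Proof. by rewrite eq_sym dtail_neq_dhead. Qed.

Let y : {u : vert G | u != v} := Sub (dhead db) head_neq.
Let b := db.1.

Lemma endpt_neq e s : e != da.1 -> e != db.1 -> endpt e s != v.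
Proof.
move=> ea eb; apply/negP=> /eqP ev.
have : e \in cut [set v] by rewrite cut1 inE /incident; apply/existsP; exists s; rewrite ev.
by rewrite deg2 !inE (negPf ea) (negPf eb).
Qed.

Lemma suppress_b s : retract y (endpt b s) = y.
Proof.
apply: val_inj; rewrite val_retract.
have [E|E] := eqVneq s db.2; first by rewrite E -[endpt _ _]/v eqxx.
have -> : s = ~~ db.2 by case: s db.2 E => [] [].
by rewrite -[endpt _ _]/(dhead db) head_neq.
Qed.

Lemma retract_head_a : val (retract y (dhead da)) = dhead da.
Proof. by rewrite val_retract ifT // /v -tab eq_sym dtail_neq_dhead. Qed.

(** The edge of [da] joins the two distinct neighbours of [v] after the contraction, and the
    remaining edges avoid [v]. *)
Lemma suppress_loopless (e : {e : edge G | e != b}) :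
  retract y (endpt (val e) false) != retract y (endpt (val e) true).
Proof.
apply: contra hab => /eqP/(congr1 val).
have [Ea|ea] := eqVneq (val e) da.1; last first.
  rewrite !val_retract !endpt_neq ?(valP e) // => E.
  by have := loopless (val e); rewrite E eqxx.
rewrite Ea => E; apply/eqP.
have: val (retract y (dtail da)) = val (retract y (dhead da)).
  by rewrite /dtail /dhead; case: (da.2); rewrite E.
by rewrite retract_head_a val_retract tab eqxx.
Qed.

Definition suppression : mgraph := contraction suppress_loopless.

Definition lift_dart (d : dart suppression) : dart G := (val d.1, d.2).

Lemma lift_dart_inj : injective lift_dart.
Proof. by move=> [e s] [e' s'] [/val_inj -> ->]. Qed.

(* The edge of [da] in the suppression stands for the path [da], [db] of [G]. *)
Definition subdivide (d : dart suppression) : seq (dart G) :=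
  if lift_dart d == da then [:: drev db; da]
  else if lift_dart d == drev da then [:: drev da; db] else [:: lift_dart d].

Lemma lift_dart_ends (d : dart suppression) : (lift_dart d).1 != da.1 ->
  dtail (lift_dart d) = val (dtail d) /\ dhead (lift_dart d) = val (dhead d).
Proof.
move=> ea; have eb := valP d.1.
by rewrite /dtail /dhead /= !val_retract !endpt_neq.
Qed.

Lemma subdivide_other (d : dart suppression) : (lift_dart d).1 != da.1 ->
  subdivide d = [:: lift_dart d].
Proof.
move=> ea; rewrite /subdivide.
by case: eqP => [E|_]; [|case: eqP => [E|//]]; rewrite E eqxx in ea.
Qed.

Lemma walk_lift (p : seq (dart suppression)) x z :
  da.1 \notin [seq e.1 | e <- map lift_dart p] -> walk x p z ->
  walk (val x) (map lift_dart p) (val z).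
Proof.
elim: p x => /= [x _ /eqP ->|d p IHp x] //.
rewrite inE negb_or eq_sym => /andP[ea pa] /andP[/eqP <- dp].
have [-> ->] := lift_dart_ends ea; rewrite eqxx; exact: IHp.
Qed.

Lemma subdivide_path (p : seq (dart suppression)) :
  da.1 \notin [seq e.1 | e <- map lift_dart p] ->
  flatten (map subdivide p) = map lift_dart p.
Proof.
elim: p => //= d p IHp; rewrite inE negb_or eq_sym => /andP[ea pa].
by rewrite subdivide_other //= IHp.
Qed.

Lemma tails_lift (p : seq (dart suppression)) :
  da.1 \notin [seq e.1 | e <- map lift_dart p] ->
  [seq dtail d | d <- map lift_dart p] = map val [seq dtail d | d <- p].
Proof.
elim: p => //= d p IHp; rewrite inE negb_or eq_sym => /andP[ea pa].
by rewrite IHp //; have [-> _] := lift_dart_ends ea.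
Qed.

Lemma edges_lift (p : seq (dart suppression)) :
  [seq d.1 | d <- map lift_dart p] = map val [seq d.1 | d <- p].
Proof. by rewrite -!map_comp. Qed.

Lemma simple_lift (p : seq (dart suppression)) :
  da.1 \notin [seq e.1 | e <- map lift_dart p] ->
  simple (map lift_dart p) = simple p.
Proof.
by move=> pa; rewrite /simple tails_lift // edges_lift !(map_inj_uniq val_inj).
Qed.

(** A cycle avoiding the edge of [da] lifts unchanged. Otherwise it is rotated to start with that
    edge; only the first dart is then subdivided, and the inserted vertex [v] is not on the rest. *)
Lemma subdivide_dicycle (c : seq (dart suppression)) :
  dicycle c -> dicycle (flatten (map subdivide c)).
Proof.
(* Rotating [c] rotates its subdivision, possibly by a different number of places. *)
move=> cd; have rotE i : dicycle (flatten (map subdivide (rot i c))) ->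
    dicycle (flatten (map subdivide c)).
  rewrite -{2}(cat_take_drop i c) /rot !map_cat !flatten_cat => H.
  by rewrite -(dicycle_rot (size (flatten (map subdivide (take i c))))) rot_size_cat.
have b_notin (p : seq (dart suppression)) : db.1 \notin [seq e.1 | e <- map lift_dart p].
  by apply/mapP=> -[x /mapP[d _ ->]] E; have /eqP := valP d.1; apply; exact: esym E.
have v_notin (p : seq (dart suppression)) :
    v \notin [seq val (dtail e) | e : dart suppression <- p].
  by apply/mapP=> -[x _ E]; have := valP (dtail x); rewrite -E eqxx.
have [ca|ca] := boolP (da.1 \in [seq e.1 | e <- map lift_dart c]); last first.
  rewrite subdivide_path //; case: c cd ca {rotE} => //= d p.
  rewrite !dicycle_cons inE negb_or eq_sym => /andP[dp sp] /andP[ea pa].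
  have [-> ->] := lift_dart_ends ea; rewrite walk_lift //=.
  by rewrite -[_ :: _]/(map lift_dart (d :: p)) simple_lift //= inE negb_or eq_sym ea.
case/mapP: ca => x /mapP[d dc ->] Ed; have [i p Ec] := rot_to dc.
apply: (rotE i); move: cd; rewrite -(dicycle_rot i) Ec.
rewrite dicycle_cons simple_cons => /and4P[dp dtp dep sp].
have pa : da.1 \notin [seq e.1 | e <- map lift_dart p].
  by rewrite Ed edges_lift (mem_map val_inj).
rewrite /= subdivide_path //.
have walk_p := walk_lift pa dp.
have tail_p : val (dtail d) \notin [seq dtail e | e <- map lift_dart p].
  by rewrite tails_lift // (mem_map val_inj).
have v_p : v \notin [seq dtail e | e <- map lift_dart p].
  by rewrite tails_lift // -map_comp v_notin.
have b_p := b_notin p; have s_p : simple (map lift_dart p) by rewrite simple_lift.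
have v_y : v != dhead db by rewrite dtail_neq_dhead.
have v_x : v != dhead da by rewrite /v -tab dtail_neq_dhead.
have val_v : val (retract y v) = dhead db by rewrite val_retract eqxx.
have Et : val (dtail d) = val (retract y (dtail (lift_dart d))) by [].
have Eh : val (dhead d) = val (retract y (dhead (lift_dart d))) by [].
have := dart_eq_or_rev da (lift_dart d); rewrite -Ed eqxx /subdivide.
case: eqP => [E _|nd]; last case: eqP => [E _|nr].
- rewrite -E eqxx [_ ++ _]/= dicycle_cons.
  rewrite -E tab val_v in Et; rewrite -E retract_head_a in Eh.
  move: walk_p tail_p; rewrite Et Eh => walk_p tail_p.
  rewrite /= !simple_cons /= !inE dhead_rev dtail_rev tab !negb_or.
  by split_bool.
- rewrite [_ == da]eq_sym (introF eqP nd) -E eqxx [_ ++ _]/= dicycle_cons.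
  rewrite -E dtail_rev retract_head_a in Et.
  rewrite -E dhead_rev tab val_v in Eh.
  move: walk_p tail_p; rewrite Et Eh => walk_p tail_p.
  rewrite /= !simple_cons /= !inE dhead_rev dtail_rev tab !negb_or.
  by split_bool.
- by [].
Qed.

(** A dart off the edge of [db] comes from its own copy in the suppression, [db] from the copy of
    [drev da], and [drev db] from the copy of [da]. *)
Lemma count_subdivide x :
  exists d0, forall d, count_mem x (subdivide d) = (d == d0).
Proof.
have rev_neq (d : dart G) : (drev d == d) = false.
  by case: d => e []; rewrite /drev xpair_eqE andbF.
have b_neq d : (lift_dart d).1 != db.1 := valP d.1.
have lift (z : dart G) : z.1 != db.1 -> exists d0, lift_dart d0 = z.
  by case: z => e s eb; exists (Sub e eb, s); rewrite /lift_dart SubK.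
have ne (d z : dart G) : d.1 != z.1 -> (d == z) = false.
  by move=> dz; apply: contraNF dz => /eqP->.
have ba : db.1 != da.1 by rewrite eq_sym.
have [xb|xb] := eqVneq x.1 db.1; last first.
  have [d0 E] := lift _ xb; exists d0 => d; rewrite -(inj_eq lift_dart_inj) E.
  rewrite /subdivide; rewrite eq_sym in xb.
  have [->|_] := eqVneq (lift_dart d) da.
    by rewrite /= (ne (drev db)) // addn0.
  have [->|_] := eqVneq (lift_dart d) (drev da); last by rewrite /= addn0.
  by rewrite /= (ne db) // !addn0.
have /orP[/eqP Ex|/eqP Ex] : (db == x) || (drev db == x).
  by have := dart_eq_or_rev db x; rewrite xb eqxx; do 2!case: (_ == x).
- have [d0 E] := lift (drev da) dab; exists d0 => d.
  rewrite -(inj_eq lift_dart_inj) E -Ex /subdivide.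
  have [->|_] := eqVneq (lift_dart d) da.
    by rewrite /= rev_neq (ne da) // [da == _]eq_sym rev_neq.
  have [_|_] := eqVneq (lift_dart d) (drev da).
    by rewrite /= (ne (drev da)) ?eqxx.
  by rewrite /= ne.
- have [d0 E] := lift da dab; exists d0 => d.
  rewrite -(inj_eq lift_dart_inj) E -Ex /subdivide.
  have [_|_] := eqVneq (lift_dart d) da; first by rewrite /= eqxx (ne da).
  have [_|_] := eqVneq (lift_dart d) (drev da).
    by rewrite /= (ne (drev da)) // [db == _]eq_sym rev_neq.
  by rewrite /= ne.
Qed.

Lemma subdivide_cover (C : seq (seq (dart suppression))) :
  oriented_cover C -> oriented_cover [seq flatten (map subdivide c) | c <- C].
Proof.
move=> [Cd HC]; split=> [|x].
  by apply/allP=> _ /mapP[c cC ->]; apply: subdivide_dicycle; apply: (allP Cd).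
have -> : flatten [seq flatten (map subdivide c) | c <- C] =
    flatten (map subdivide (flatten C)).
  by elim: C {Cd HC} => //= c C ->; rewrite map_cat flatten_cat.
have [d0 E] := count_subdivide x.
rewrite count_flatten -map_comp -(HC d0) -sumn_count.
by congr sumn; apply: eq_map.
Qed.

End Subdivision.

(** * Covers of 2-edge-connected graphs of maximum degree three *)

Lemma digon_cover (G : mgraph) (da db : dart G) :
  da.1 != db.1 -> dtail da = dtail db -> dhead da = dhead db ->
  (forall e : edge G, (e == da.1) || (e == db.1)) ->
  oriented_cover [:: [:: da; drev db]; [:: db; drev da]].
Proof.
move=> ab tab hab Eab; split=> [|x].
  rewrite /= !dicycle_cons /= !simple_cons /= !inE !dtail_rev !dhead_rev.
  by rewrite tab hab !eqxx dtail_neq_dhead ab eq_sym ab.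
rewrite /=.
have := dart_eq_or_rev da x; have := dart_eq_or_rev db x.
have /orP[/eqP->|/eqP->] := Eab x.1; rewrite eqxx.
  by rewrite (negPf ab); clear; lia.
by rewrite [_ == da.1]eq_sym (negPf ab); clear; lia.
Qed.

(* A degree 2 vertex with both neighbours equal only occurs in a digon, as the
   remaining edge at the neighbour would be a bridge. *)
Theorem cover_of_minors (G : mgraph) :
  1 < #|vert G| -> two_edge_connected G ->
  (forall v : vert G, #|cut [set v]| <= 3) ->
  (forall H : mgraph, C2 H -> minor H G -> exists C, @oriented_cover H C) ->
  exists C, @oriented_cover G C.
Proof.
have [n] := ubnP #|vert G|; elim: n G => // n IHn G leGn G1 G2 deg cov.
have [/existsP[v vn3]|deg3] := boolP [exists v : vert G, #|cut [set v]| != 3]; last first.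
  have {}deg3 (v : vert G) : #|cut [set v]| = 3.
    by apply/eqP; apply: contraR deg3 => nv; apply/existsP; exists v.
  apply: cov (minor_refl G); split; last by move=> v; rewrite -cut1.
  exact: two_connected_of_2ec.
have [w wv] : exists w, w != v.
  have /card_gt1P[x [z [_ _ xz]]] := G1.
  by have [xv|xv] := eqVneq x v; [exists z; rewrite -xv eq_sym | exists x].
have deg2 : #|cut [set v]| == 2.
  have := two_edge_connectedP _ G2 [set v] v w; rewrite !inE eqxx => /(_ isT wv).
  by have := deg v; move: vn3; clear; lia.
have /cards2P[a [b [ab Ecut]]] := deg2.
have [da [Ea dav]] : exists d : dart G, d.1 = a /\ dtail d = v.
  by apply: incident_dart; rewrite Ecut !inE eqxx.
have [db [Eb dbv]] : exists d : dart G, d.1 = b /\ dtail d = v.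
  by apply: incident_dart; rewrite Ecut !inE eqxx orbT.
move: dav; subst a b v => dav.
have [hab|hab] := eqVneq (dhead da) (dhead db).
  exists [:: [:: da; drev db]; [:: db; drev da]]; apply: digon_cover => // e.
  set v := dtail db in Ecut dav; set z := dhead da in hab.
  have zab : [set da.1; db.1] \subset cut [set z].
    apply/subsetP=> f; rewrite cut1 !inE => /orP[]/eqP->.
      exact: incident_dhead.
    by rewrite hab incident_dhead.
  have VE u : (u == v) || (u == z).
    rewrite -[_ || _]negbK; apply/negP=> uvz.
    have := two_edge_connectedP _ G2 [set v; z] v u; rewrite !inE eqxx uvz.
    move=> /(_ isT isT); suff sub : cut [set v; z] \subset cut [set z] :\: [set da.1; db.1].
      have := subset_leq_card sub; rewrite cardsD (setIidPr zab) cards2 ab.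
      by have := deg z; clear; lia.
    apply/subsetP=> f fvz; have fab : f \notin [set da.1; db.1].
      apply: contraL fvz; rewrite in_set2 => /orP[]/eqP->.
        by rewrite in_cut dav !inE /z !eqxx !orbT.
      by rewrite in_cut -hab !inE /v /z !eqxx !orbT.
    rewrite inE fab; move: fab fvz; rewrite -Ecut !inE.
    by case: (_ == v) (_ == v) => [] [].
  have : e \in cut [set v].
    have := loopless e; rewrite inE !in_set1.
    have /orP[/eqP->|/eqP->] := VE (endpt e false);
      have /orP[/eqP->|/eqP->] := VE (endpt e true); rewrite ?eqxx //.
      by rewrite [z == v]eq_sym => /negPf->.
    by move=> /negPf->.
  by rewrite Ecut !inE.
(* The two neighbours of the vertex of degree 2 differ, so it can be suppressed; the induction
   hypothesis covers [K], and subdividing carries that cover back. *)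
pose K := suppression dav hab Ecut.
have HK : forall H, C2 H -> minor H K -> exists C, @oriented_cover H C.
  move=> H H2 HK; apply: (cov H H2); apply: minor_trans HK _.
  by apply: contraction_minor (suppress_b db) _; rewrite Ecut !inE eqxx orbT.
have [] := IHn K _ _ (contraction_2ec _ (suppress_b db) G2) _ HK.
- rewrite -ltnS; apply: leq_trans leGn; rewrite ltnS card_sig.
  by rewrite [X in _ < X](cardD1 (dtail db)) inE ltnS subset_leq_card //;
     apply/subsetP=> u; rewrite !inE andbT.
- apply/card_gt1P.
  exists (Sub (dhead db) (head_neq db)), (retract (Sub (dhead db) (head_neq db)) (dhead da)).
  split=> //; apply: contra (hab) => /eqP/(congr1 val); rewrite retract_head_a //.
  by move=> /= ->.
- move=> {w wv}w; rewrite (cut_contraction (suppress_b db)).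
  set y := Sub (dhead db) _; have [->|wy] := eqVneq w y.
    have -> : retract y @^-1: [set y] = [set dtail db; dhead db].
      apply/setP=> u; rewrite !inE -(inj_eq val_inj) val_retract /=.
      by have [_|] := eqVneq u (dtail db); rewrite ?eqxx.
    (* The merged vertex keeps degree at most 3, as it loses the edge of [db] and gains that of
       [da]. *)
    suff: cut [set dtail db; dhead db] \subset da.1 |: (cut [set dhead db] :\ db.1).
      move=> /subset_leq_card/leq_trans; apply; rewrite cardsU1.
      have := deg (dhead db); rewrite (cardsD1 db.1) cut1 inE incident_dhead.
      by rewrite -cut1; case: (_ \notin _); clear; lia.
    apply/subsetP=> f fvy; have fb : f != db.1.
      by apply: contraTneq fvy => ->; rewrite in_cut !inE !eqxx !orbT.
    have [->|fa] := eqVneq f da.1; first by rewrite !inE eqxx.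
    rewrite in_setU1 in_setD1 fb (negPf fa) /=.
    have : f \notin cut [set dtail db] by rewrite Ecut !inE negb_or fa.
    by move: fvy; rewrite !inE; do 2!case: (_ == dtail db).
  have -> : retract y @^-1: [set w] = [set val w]; last exact: deg.
  apply/setP=> u; rewrite !inE -(inj_eq val_inj) val_retract.
  have [->|//] := eqVneq u (dtail db).
  rewrite -[(val y == _)]/(y == w) eq_sym (negPf wy).
  by have := valP w; rewrite eq_sym => /negPf->.
- move=> C HC; exists [seq flatten (map (@subdivide _ _ _ dav hab Ecut) c) | c <- C].
  exact: subdivide_cover.
Qed.

(** * Uncrossing *)

Definition deletion (G : mgraph) (e e' : edge G) : mgraph :=
  @MGraph (vert G) {f : edge G | (f != e) && (f != e')}
    (fun f => endpt (val f)) (fun f => loopless (val f)).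

Lemma deletion_minor (G : mgraph) (e e' : edge G) : minor (deletion e e') G.
Proof.
exists (@Some _), val; split=> [x|x||f]; first by exists x.
- by move=> u w; rewrite !inE => /eqP[->] /eqP[->]; exact: connect0.
- exact: val_inj.
- by exists false.
Qed.

Lemma cut_deletion (G : mgraph) (e e' : edge G) (S : {set vert G}) :
  #|@cut (deletion e e') S| = #|cut S :\: [set e; e']|.
Proof.
rewrite -(card_imset _ (val_inj : injective (val : edge (deletion e e') -> edge G))).
apply: eq_card => f; rewrite in_setD in_set2 negb_or.
apply/imsetP/andP => [[g gS ->]|[fee fS]].
  by rewrite (valP g); move: gS; rewrite !inE.
by exists (Sub f fee : edge (deletion e e')); rewrite ?SubK //; move: fS; rewrite !inE.
Qed.

Lemma deletion_cover (G : mgraph) (e e' : edge G)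
    (C : seq (seq (dart (deletion e e')))) : oriented_cover C ->
  exists C', @cover_avoiding G e e' C'.
Proof.
move=> [Cd HC]; pose f (d : dart (deletion e e')) : dart G := (val d.1, d.2).
have f_inj : injective f by move=> [g s] [g' s'] [/val_inj -> ->].
exists (map (map f) C); split=> [|x].
  apply/allP=> _ /mapP[c /(allP Cd) cd ->]; case: c cd => // d p.
  rewrite map_cons !dicycle_cons -map_cons => /andP[dp sp]; apply/andP; split.
    suff walk_f x y : walk x p y -> @walk G x (map f p) y by exact: walk_f dp.
    by elim: p x {dp sp} => //= g p IHp x /andP[-> /IHp].
  move: sp => /andP[Ut Ue]; apply/andP; split; first by rewrite -map_comp.
  by move: Ue; rewrite -(map_inj_uniq val_inj) -!map_comp.
rewrite -map_flatten; have [xee|xee] := boolP ((x.1 != e) && (x.1 != e')).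
  case: x xee => g s gee; rewrite count_map.
  pose d0 : dart (deletion e e') := (Sub g gee, s).
  rewrite -[RHS](HC d0); apply: eq_count => d.
  by rewrite /= -(inj_eq f_inj).
apply/eqP; rewrite -leqn0 leqNgt -has_count has_pred1; apply: contra xee.
by case/mapP=> d _ ->; exact: valP d.1.
Qed.

Lemma not_two_edge_connected (G : mgraph) : ~~ two_edge_connected G ->
  exists (S : {set vert G}) x y, [/\ x \in S, y \notin S & #|cut S| <= 1].
Proof.
case/forallPn=> S; rewrite negb_imply -leqNgt => /andP[/andP[/set0Pn[x xS]]].
rewrite -(inj_eq (@setC_inj _)) setCT => /set0Pn[y]; rewrite inE => yS cS.
by exists S, x, y.
Qed.

(* Removing [v] from [X] leaves a set whose only cut edge is the third edge
   at [v]. *)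
Lemma corner_absurd (G : mgraph) (v u : vert G) (X : {set vert G}) e e' :
  two_edge_connected G -> #|cut [set v]| = 3 -> v \in X -> u \notin X ->
  e != e' -> e \in cut [set v] -> e' \in cut [set v] ->
  ~ cut X \subset [set e; e'].
Proof.
move=> /two_edge_connectedP G2 v3 vX uX ee' ev e'v sub.
have EX : cut X = [set e; e'].
  apply/eqP; rewrite eqEcard sub cards2 ee'; exact: G2 vX uX.
have sub' : cut (X :\ v) \subset cut [set v] :\: [set e; e'].
  apply/subsetP=> _ /cut_dart[d [<-]]; rewrite in_setD1 => /andP[dv dX] d'X.
  have [hv|hv] := eqVneq (dhead d) v.
    by rewrite in_setD -EX !in_cut dX hv vX !in_set1 (negPf dv) !eqxx.
  move: d'X; rewrite in_setD1 hv /= => d'X.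
  have dEX : d.1 \in cut X by rewrite in_cut dX (negPf d'X).
  have : d.1 \in cut [set v].
    by move: dEX; rewrite EX => /set2P[]->.
  by rewrite in_cut !in_set1 (negPf dv) (negPf hv).
have [z zX] : exists z, z \in X :\ v.
  apply/set0Pn; apply: contra_eq_neq v3 => E.
  by rewrite -(setD1K vX) E setU0 in EX; rewrite EX cards2 ee'.
have := G2 _ z v zX; rewrite !inE eqxx => /(_ isT).
have := subset_leq_card sub'; rewrite cardsD (setIidPr _) ?v3 ?cards2 ?ee'.
  by clear; lia.
by apply/subsetP=> f /set2P[]->.
Qed.

(** The edges of [d2] and [d3] have both ends outside [Q], so the cut of [Q] could only consist of
    the two edges of the 4-cycle at [dtail d1]. *)
Lemma quad_corner (G : mgraph) (d1 d2 d3 d4 : dart G) (Q : {set vert G}) :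
  two_edge_connected G -> (forall v : vert G, #|cut [set v]| = 3) ->
  dicycle [:: d1; d2; d3; d4] ->
  dtail d1 \in Q -> dtail d2 \notin Q -> dtail d3 \notin Q -> dtail d4 \notin Q ->
  ~ {subset cut Q <= [:: d1.1; d2.1; d3.1; d4.1]}.
Proof.
move=> G2 G3 D4 v1 v2 v3 v4 sub; have [[h1 h2 h3 h4] _] := dicycle4 D4.
have e14 : d1.1 != d4.1.
  by move: D4; rewrite dicycle_cons !simple_cons /= !inE; split_bool.
apply: (corner_absurd G2 (G3 (dtail d1)) v1 v2 e14).
- by rewrite cut1 inE incident_dtail.
- by rewrite cut1 inE -h4 incident_dhead.
- apply/subsetP=> f fQ; have := sub f fQ; rewrite !inE; case/or4P => /eqP E.
  + by rewrite E eqxx.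
  + by move: fQ; rewrite E in_cut h2 (negPf v2) (negPf v3).
  + by move: fQ; rewrite E in_cut h3 (negPf v3) (negPf v4).
  + by rewrite E eqxx orbT.
Qed.

Lemma quad_corner_side (G : mgraph) (d1 d2 d3 d4 : dart G) (S : {set vert G}) c :
  two_edge_connected G -> (forall v : vert G, #|cut [set v]| = 3) ->
  dicycle [:: d1; d2; d3; d4] ->
  (dtail d1 \in S) = ~~ c -> (dtail d2 \in S) = c -> (dtail d3 \in S) = c ->
  (dtail d4 \in S) = c -> ~ {subset cut S <= [:: d1.1; d2.1; d3.1; d4.1]}.
Proof.
move=> G2 G3 D4; case: c => /= s1 s2 s3 s4; last first.
  by apply: quad_corner; rewrite ?s1 ?s2 ?s3 ?s4.
by rewrite -cutC; apply: quad_corner; rewrite // inE ?s1 ?s2 ?s3 ?s4.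
Qed.

Lemma dicycle4_rot (G : mgraph) (d1 d2 d3 d4 : dart G) :
  dicycle [:: d1; d2; d3; d4] -> dicycle [:: d2; d3; d4; d1].
Proof. by rewrite -(dicycle_rot 1). Qed.

(* A cut witnessing that deleting [e] and [e'] destroys 2-edge-connectivity. *)
Definition weak_cut (G : mgraph) (e e' : edge G) (S : {set vert G}) :=
  [/\ 1 < #|cut S| & #|cut S :\: [set e; e']| <= 1].

(** If [S] separated the ends of [d1], this would be its only cut edge besides [d2] and [d4]. Then
    [d3] does not cross, so either the tail of [d1] or that of [d2] is alone on its side, against
    [quad_corner_side]. *)
Lemma weak_cut_side (G : mgraph) (d1 d2 d3 d4 : dart G) (S : {set vert G}) :
  two_edge_connected G -> (forall v : vert G, #|cut [set v]| = 3) ->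
  dicycle [:: d1; d2; d3; d4] -> weak_cut d2.1 d4.1 S ->
  (dtail d1 \in S) = (dtail d2 \in S).
Proof.
move=> G2 G3 D4 [_ /card_le1_eqP S1]; have [[h1 h2 h3 h4] _] := dicycle4 D4.
apply/eqP; apply: contraT => s12.
have [e12 e14 e13 e32 e34] : [/\ d1.1 != d2.1, d1.1 != d4.1, d1.1 != d3.1,
    d3.1 != d2.1 & d3.1 != d4.1].
  by split; move: D4; rewrite dicycle_cons !simple_cons /= !inE; split_bool.
have e1S : d1.1 \in cut S :\: [set d2.1; d4.1].
  by rewrite in_setD in_set2 negb_or e12 e14 in_cut h1.
have s34 : (dtail d3 \in S) = (dtail d4 \in S).
  apply/eqP; apply: contraNT e13 => s34; apply/eqP; apply: S1 => //.
  by rewrite in_setD in_set2 negb_or e32 e34 in_cut h3.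
have sub : {subset cut S <= [:: d1.1; d2.1; d3.1; d4.1]}.
  move=> f fS; rewrite !inE; have [->|f2] := eqVneq f d2.1; first by rewrite orbT.
  have [->|f4] := eqVneq f d4.1; first by rewrite !orbT.
  by rewrite (_ : f = d1.1) ?eqxx //; apply: S1; rewrite // in_setD in_set2 negb_or f2 f4.
have [s23|s23] := eqVneq (dtail d2 \in S) (dtail d3 \in S).
  case: (quad_corner_side (c := dtail d2 \in S) G2 G3 D4 _ _ _ _ sub) => //.
    by move: s12; do 2!case: (_ \in S).
  by rewrite -s34.
suff: False by [].
apply: (quad_corner_side (S := S) (c := dtail d1 \in S) G2 G3 (dicycle4_rot D4)) => //.
- by move: s12; do 2!case: (_ \in S).
- by move: s12 s23; do 3!case: (_ \in S).
- by rewrite -s34; move: s12 s23; do 3!case: (_ \in S).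
- by move=> f /sub; rewrite -(mem_rot 1).
Qed.

Lemma weak_cut_sym (G : mgraph) (e e' : edge G) S :
  weak_cut e e' S -> weak_cut e' e S.
Proof. by rewrite /weak_cut setUC. Qed.

(** By [weak_cut_side] neither [d1] nor [d3] crosses. With all four vertices on one side, [d2] and
    [d4] would not cross either, and deleting them would leave the whole cut, which has at least two
    edges. *)
Lemma weak_cut_shape (G : mgraph) (d1 d2 d3 d4 : dart G) (S : {set vert G}) :
  two_edge_connected G -> (forall v : vert G, #|cut [set v]| = 3) ->
  dicycle [:: d1; d2; d3; d4] -> weak_cut d2.1 d4.1 S ->
  [/\ (dtail d1 \in S) = (dtail d2 \in S), (dtail d3 \in S) = (dtail d4 \in S) &
      (dtail d3 \in S) = ~~ (dtail d2 \in S)].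
Proof.
move=> G2 G3 D4 WS; have s12 := weak_cut_side G2 G3 D4 WS.
have s34 := weak_cut_side G2 G3 (dicycle4_rot (dicycle4_rot D4)) (weak_cut_sym WS).
split=> //; have [[h1 h2 h3 h4] _] := dicycle4 D4.
case: WS => S2 S1; apply/eqP; apply: contraTT S2 => s23; rewrite -leqNgt.
have s23' : (dtail d3 \in S) = (dtail d2 \in S).
  by move: s23; do 2!case: (_ \in S).
suff <- : cut S :\: [set d2.1; d4.1] = cut S by [].
apply/setDidPl; rewrite -setI_eq0; apply/eqP/setP=> f; rewrite in_setI in_set2 in_set0.
apply/negP=> /andP[fS /orP[]/eqP E]; move: fS; rewrite E in_cut.
  by rewrite h2 s23' eqxx.
by rewrite h4 -s34 s23' s12 eqxx.
Qed.

Lemma uncrossing (G : mgraph) (d1 d2 d3 d4 : dart G) :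
  two_edge_connected G -> (forall v : vert G, #|cut [set v]| = 3) ->
  dicycle [:: d1; d2; d3; d4] ->
  two_edge_connected (deletion d2.1 d4.1) || two_edge_connected (deletion d3.1 d1.1).
Proof.
move=> G2 G3 D4; have [[h1 h2 h3 h4] _] := dicycle4 D4.
rewrite -[_ || _]negbK negb_or; apply/negP=> /andP[].
have weak e e' : ~~ two_edge_connected (deletion e e') ->
    exists S : {set vert G}, weak_cut e e' S.
  move=> /not_two_edge_connected[S [x [y [xS yS S1]]]]; exists S.
  split; last by rewrite -cut_deletion.
  exact: (two_edge_connectedP _ G2 _ _ _ xS yS).
move=> /weak[S WS] /weak[T WT].
(* With v1, ..., v4 the tails in order, [S] separates v1, v2 from v3, v4, while [T] separates v2, v3
   from v4, v1. *)
have [s12 s34 s23] := weak_cut_shape G2 G3 D4 WS.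
have [t23 t41 t34] := weak_cut_shape G2 G3 (dicycle4_rot D4) WT.
set A := cut S :\: [set d2.1; d4.1]; set B := cut T :\: [set d3.1; d1.1].
have /card_le1_eqP A1 : #|A| <= 1 by case: WS.
have /card_le1_eqP B1 : #|B| <= 1 by case: WT.
(* All edges of [A] and [B] are off the 4-cycle, as [d1] and [d3] do not cross [S], nor [d2] and
   [d4] cross [T]. So an edge of one set that crosses the other cut lies in both sets. *)
have AB f : f \in A -> f \in cut T -> f \in B.
  rewrite in_setD => /andP[_ fS] fT; rewrite in_setD fT andbT in_set2.
  by apply: contraL fS => /orP[]/eqP->; rewrite in_cut ?h3 ?h1 ?s34 ?s12 eqxx.
have BA f : f \in B -> f \in cut S -> f \in A.
  rewrite in_setD => /andP[_ fT] fS; rewrite in_setD fS andbT in_set2.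
  by apply: contraL fT => /orP[]/eqP->; rewrite in_cut ?h2 ?h4 ?t23 ?t41 eqxx.
(* [S] and [T] cross, each quadrant containing one vertex of the 4-cycle, and at
   most one edge of each cut is off the 4-cycle; so these edges miss a quadrant,
   whose cut then consists of the two edges of the 4-cycle at its vertex. *)
have [[sg tau] free] : exists c : bool * bool, forall f b, f \in A :|: B ->
    ((endpt f b \in S) != c.1) || ((endpt f b \in T) != c.2).
  (* An edge crossing both cuts is the only element of [A] and of [B]. The quadrant on the [S]-side
     of one of its ends and the [T]-side of the other contains neither end. *)
  have [/exists_inP[f fA fT]|nAT] := boolP [exists f in A, f \in cut T].
    have fB := AB f fA fT; exists (endpt f false \in S, endpt f true \in T) => g b.
    rewrite in_setU => gAB; have -> : g = f by case/orP: gAB => gX; [apply: A1 | apply: B1].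
    move: (fA) fT; rewrite !inE => /andP[_ fS] fT.
    by case: b => /=; [rewrite eq_sym fS | rewrite fT orbT].
  (* Now the edge of [A] lies on one side of [T], and that of [B] on one side of [S]; the opposite
     sides are chosen, or arbitrarily [true] if there is no such edge. *)
  pose sg := if [pick f in B] is Some f then endpt f false \notin S else true.
  pose tau := if [pick f in A] is Some f then endpt f false \notin T else true.
  exists (sg, tau) => f b /setUP[fA|fB].
    have fT : f \notin cut T.
      by apply: contra nAT => fT; apply/exists_inP; exists f.
    have -> : tau = (endpt f false \notin T).
      by rewrite /tau; case: pickP => [g gA|/(_ f)]; [rewrite (A1 _ _ fA gA) | rewrite fA].
    by move: fT; rewrite inE negbK; case: b => /eqP E; rewrite ?E; case: (_ \in T); rewrite orbT.
  have fS : f \notin cut S.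
    apply: contra nAT => fS; apply/exists_inP; exists f; first exact: BA.
    by move: fB; rewrite in_setD => /andP[].
  have -> : sg = (endpt f false \notin S).
    by rewrite /sg; case: pickP => [g gB|/(_ f)]; [rewrite (B1 _ _ fB gB) | rewrite fB].
  by move: fS; rewrite inE negbK; case: b => /eqP E; rewrite ?E; case: (_ \in S).
pose Q := [set u | ((u \in S) == sg) && ((u \in T) == tau)].
(* An edge leaving [Q] has an end in [Q], so it is outside [A] and [B]; but it crosses [S] or [T],
   so it belongs to the 4-cycle. *)
have sub : {subset cut Q <= [:: d1.1; d2.1; d3.1; d4.1]}.
  move=> f fQ; have fAB : f \notin A :|: B.
    apply/negP=> /free H; move: fQ (H false) (H true); rewrite !inE /=.
    by do 2!case: (_ == sg); do 2!case: (_ == tau).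
  have : (f \in cut S) || (f \in cut T).
    move: fQ; rewrite !inE; do 2!case: (_ \in S) ; do 2!case: (_ \in T);
      by case: (sg); case: (tau).
  move: fAB; rewrite in_setU !in_setD !in_set2 !in_cons in_nil.
  by do 4!case: (f == _) => //=; case: (f \in cut S); case: (f \in cut T).
have inQ u : (u \in Q) = ((u \in S) == sg) && ((u \in T) == tau) by rewrite inE.
have sub2 : {subset cut Q <= [:: d2.1; d3.1; d4.1; d1.1]}.
  by move=> f /sub; rewrite -(mem_rot 1).
have sub3 : {subset cut Q <= [:: d3.1; d4.1; d1.1; d2.1]}.
  by move=> f /sub2; rewrite -(mem_rot 1).
have sub4 : {subset cut Q <= [:: d4.1; d1.1; d2.1; d3.1]}.
  by move=> f /sub3; rewrite -(mem_rot 1).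
have D2 := dicycle4_rot D4; have D3 := dicycle4_rot D2; have D1 := dicycle4_rot D3.
have inQ' := (inQ, =^~ s34, s23, s12, =^~ t41, t34, =^~ t23).
(* In the order of the four cases, the vertex of the 4-cycle in [Q] is the tail of [d2], [d1], [d3],
   [d4]. *)
have [Esg|Esg] := eqVneq sg (dtail d2 \in S);
  have [Etau|Etau] := eqVneq tau (dtail d2 \in T).
- apply: (quad_corner G2 G3 D2 _ _ _ _ sub2); rewrite !inQ' Esg Etau;
    by case: (_ \in S); case: (_ \in T).
- apply: (quad_corner G2 G3 D4 _ _ _ _ sub); rewrite !inQ' Esg; move: Etau;
    by case: (_ \in S); case: (_ \in T); case: (tau).
- apply: (quad_corner G2 G3 D3 _ _ _ _ sub3); rewrite !inQ' Etau; move: Esg;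
    by case: (_ \in S); case: (_ \in T); case: (sg).
- apply: (quad_corner G2 G3 D1 _ _ _ _ sub4); rewrite !inQ';
    move: Esg Etau; by case: (_ \in S); case: (_ \in T); case: (sg); case: (tau).
Qed.

(** * Minimal counterexamples *)

Lemma embedding_dec (G : mgraph) :
  ~ ~ has_orientable_closed_2cell_embedding G -> has_orientable_closed_2cell_embedding G.
Proof.
(* Rotation systems range over a finite type, so their existence is decided by a boolean search. *)
pose P (r : {perm dart G}) :=
  [forall d : dart G, [forall d' : dart G, (d' \in porbit r d) == (dtail d' == dtail d)]]
  && [forall d : dart G, dicycle (orbit (face r) d)].
have PE r : P r -> has_orientable_closed_2cell_embedding G.
  move=> /andP[/forallP Pr /forallP Pd]; exists r; split=> // d d'.
  exact: eqP (forallP (Pr d) d').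
have [/existsP[r /PE]//|nP nn] := boolP [exists r, P r].
case: nn => -[r [rr rd]]; case/existsP: nP; exists r; apply/andP; split.
  by apply/forallP=> d; apply/forallP=> d'; apply/eqP; apply: rr.
exact/forallP.
Qed.

Lemma has_4cycle_darts (G : mgraph) : has_4cycle G ->
  exists d1 d2 d3 d4 : dart G, dicycle [:: d1; d2; d3; d4].
Proof. by move=> [[|d1 [|d2 [|d3 [|d4 [|d5 p]]]]] [cd sz]] //; exists d1, d2, d3, d4. Qed.

Theorem lemma4p2 (GG : mgraph -> Prop)
  (GG_sub : forall G : mgraph, GG G -> C2 G)
  (GG_minor : forall G1 G2 : mgraph, GG G1 -> C2 G2 -> minor G2 G1 -> GG G2) :
  (forall G : mgraph, C2 G ->
     (has_orientable_closed_2cell_embedding G <-> has_orientable_cdc G)) /\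
  (forall G : mgraph, GG G ->
     ~ has_orientable_closed_2cell_embedding G ->
     (forall G' : mgraph, GG G' ->
        ~ has_orientable_closed_2cell_embedding G' ->
        #|edge G| <= #|edge G'|) ->
     ~ has_4cycle G).
Proof.
split=> [G [_ G3]|G GGG nemb minG /has_4cycle_darts[d1 [d2 [d3 [d4 D4]]]]].
  rewrite has_orientable_cdcP; split; first exact: embedding_cover.
  by case=> C; apply: cover_embedding G3.
have [G2c G3] := GG_sub G GGG.
have deg (v : vert G) : #|cut [set v]| = 3 by rewrite cut1; exact: G3.
have G2 : two_edge_connected G.
  by apply: (two_connected_2ec G2c) => v; rewrite deg.
(* Stated for an arbitrary 4-cycle, to be used for the given one and for its rotation by one
   place. *)
apply: nemb; have lift (e1 e2 e3 e4 : dart G) : dicycle [:: e1; e2; e3; e4] ->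
    two_edge_connected (deletion e2.1 e4.1) -> has_orientable_closed_2cell_embedding G.
  move=> E4 K2; have [C HC] : exists C, @oriented_cover (deletion e2.1 e4.1) C.
    apply: cover_of_minors => // [|v|H H2 HK]; first by case: G2c.
      rewrite cut_deletion -(deg v); exact: subset_leq_card (subsetDl _ _).
    (* Minimality of [G] only refutes that [H] lacks an embedding, whence the double negation. *)
    apply/embedding_cover/embedding_dec => nH.
    have GH : GG H by apply: (GG_minor G) => //; apply: minor_trans HK (deletion_minor _ _).
    (* The edges of [H] inject into those of the deletion, which lacks [e2.1], so [H] has fewer
       edges than [G]. *)
    have := minG H GH nH; case: HK => phi [psi [_ _ psi_inj _]].
    rewrite leqNgt => /negP[]; apply: leq_ltn_trans (leq_card psi psi_inj) _.
    rewrite card_sig [X in _ < X](cardD1 e2.1) inE ltnS subset_leq_card //.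
    by apply/subsetP=> f; rewrite !inE andbT => /andP[].
  have [C' HC'] := deletion_cover HC; have [C'' HC''] := cover_lift G3 E4 HC'.
  exact: cover_embedding G3 HC''.
case/orP: (uncrossing G2 deg D4); first exact: lift D4.
exact: lift (dicycle4_rot D4).
Qed.
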